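(* Let $d\ge1$, $\kappa\ge0$, and let $x_1(t),\dots,x_N(t)\in\mathbb S^d$, $t\ge0$, be a solution of $$\dot x_i=\frac{\kappa}{N}\sum_{j=1}^N\big(x_j-\langle x_i,x_j\rangle x_i\big),\qquad x_i(0)=x_i^0\in\mathbb S^d,\qquad i=1,\dots,N,$$ such that all the initial positions $x_i^0$ are different from each other. Let $\mathcal N\in\mathbb S^d$ and $\mathcal S=-\mathcal N$ be a pair of opposite poles, and let $\mathcal M_{\mathcal N}$ and $\mathcal M_{\mathcal S}$ be the numbers of indices $i$ for which $x_i(t)\to\mathcal N$ and $x_i(t)\to\mathcal S$ as $t\to\infty$, respectively. Then $$\min\{\mathcal M_{\mathcal N},\mathcal M_{\mathcal S}\}\le1.$$
   Context: $\mathbb S^d$ is the unit sphere in $\mathbb R^{d+1}$ with Euclidean inner product $\langle\cdot,\cdot\rangle$. *)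

(* Defs.v *)
From HB Require Import structures.
From mathcomp Require Import all_boot all_order all_algebra.
From mathcomp Require Import all_classical all_reals all_analysis.
Import Order.TTheory GRing.Theory Num.Theory.
Import numFieldNormedType.Exports.

Set Implicit Arguments.
Unset Strict Implicit.
Unset Printing Implicit Defensive.

Local Open Scope classical_set_scope.
Local Open Scope ring_scope.

Definition dotp (R : realType) (n : nat) (u v : 'rV[R]_n) : R :=
  \sum_(k < n) u 0 k * v 0 k.

Definition sphere (R : realType) (d : nat) : set 'rV[R]_d.+1 :=
  [set u | Num.sqrt (dotp u u) = 1].
Arguments sphere : clear implicits.

Definition lohe_field (R : realType) (d N : nat) (kappa : R)
    (y : 'I_N -> 'rV[R]_d.+1) (i : 'I_N) : 'rV[R]_d.+1 :=
  (kappa / N%:R) *: \sum_(j < N) (y j - dotp (y i) (y j) *: y i).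

(* Trajectories are total functions of time, but only their restriction to
   [0, +oo[ is constrained: the derivative at 0 is the right derivative. *)
Definition lohe_solution (R : realType) (d N : nat) (kappa : R)
    (x0 : 'I_N -> 'rV[R]_d.+1) (x : 'I_N -> R -> 'rV[R]_d.+1) : Prop :=
  [/\ forall i (t : R), 0 <= t -> x i t \in sphere R d,
      forall i, x i 0 = x0 i,
      forall i, (h^-1 *: (x i h - x i 0)) @[h --> 0^'+]
                  --> lohe_field kappa (x^~ 0) i
    & forall i (t : R), 0 < t -> is_derive t 1 (x i) (lohe_field kappa (x^~ t) i)].

Definition num_converging (R : realType) (d N : nat)
    (x : 'I_N -> R -> 'rV[R]_d.+1) (p : 'rV[R]_d.+1) : nat :=
  #|[pred i : 'I_N | `[< x i t @[t --> +oo] --> p >]]|.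

(* Main.v *)
(* Along a solution, 1 - <x_i, x_j> has logarithmic derivative
   - (c_i + c_j), where c_i = kappa/N sum_m <x_i, x_m>; hence the cross ratio
   of the squared distances between four particles is conserved. If x_i, x_j
   tended to a pole and x_k, x_l to the opposite one, the cross ratio
   (1 - <x_i, x_j>) (1 - <x_k, x_l>) / ((1 - <x_i, x_k>) (1 - <x_j, x_l>))
   would tend to 0, although it is positive at time 0. *)
Require Import Defs.
From HB Require Import structures.
From mathcomp Require Import all_boot all_order all_algebra.
From mathcomp Require Import all_classical all_reals all_analysis.
From mathcomp Require Import ring lra.
Import Order.TTheory GRing.Theory Num.Theory.
Import numFieldNormedType.Exports.

Local Open Scope classical_set_scope.
Local Open Scope ring_scope.

(** * Inner product: bilinearity, limits, product rule *)

Section dotp.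
Context {R : realType} {n : nat}.
Implicit Types (u v w : 'rV[R]_n) (a : R).

Lemma dotpC u v : dotp u v = dotp v u.
Proof. by apply: eq_bigr => k _; rewrite mulrC. Qed.

Lemma dotpDl u v w : dotp (u + v) w = dotp u w + dotp v w.
Proof.
by rewrite -big_split; apply: eq_bigr => k _ /=; rewrite mxE mulrDl.
Qed.

Lemma dotpZl a u w : dotp (a *: u) w = a * dotp u w.
Proof. by rewrite mulr_sumr; apply: eq_bigr => k _; rewrite mxE mulrA. Qed.

Lemma dotpNl u w : dotp (- u) w = - dotp u w.
Proof. by rewrite -scaleN1r dotpZl mulN1r. Qed.

Lemma dotp_suml (I : Type) (r : seq I) (f : I -> 'rV[R]_n) w :
  dotp (\sum_(i <- r) f i) w = \sum_(i <- r) dotp (f i) w.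
Proof.
apply: (big_morph (fun u => dotp u w) (fun u v => dotpDl u v w)).
by apply: big1 => k _; rewrite mxE mul0r.
Qed.

Lemma dotpDr u v w : dotp u (v + w) = dotp u v + dotp u w.
Proof. by rewrite dotpC dotpDl !(dotpC u). Qed.

Lemma dotpNr u v : dotp u (- v) = - dotp u v.
Proof. by rewrite dotpC dotpNl dotpC. Qed.

Lemma dotp_ge0 u : 0 <= dotp u u.
Proof. by apply: sumr_ge0 => k _; rewrite -expr2 sqr_ge0. Qed.

Lemma dotp_eq0 u : dotp u u = 0 -> u = 0.
Proof.
move=> /eqP; rewrite psumr_eq0 => [/allP u0|k _]; last by rewrite -expr2 sqr_ge0.
apply/rowP => k; rewrite mxE.
by have := u0 k (mem_index_enum k); rewrite /= mulf_eq0 orbb => /eqP.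
Qed.

Lemma cvg_dotp {T : Type} {F : set_system T} {FF : Filter F}
    (f g : T -> 'rV[R]_n) u v :
  f @ F --> u -> g @ F --> v -> dotp (f t) (g t) @[t --> F] --> dotp u v.
Proof.
move=> fu gv.
have coord (h : T -> 'rV[R]_n) w k : h @ F --> w -> h t 0 k @[t --> F] --> w 0 k.
  by move=> hw; exact: (cvg_comp h _ hw (@coord_continuous R 1 n 0 k w)).
rewrite /dotp; apply: cvg_big => [|k _]; first exact: add_continuous.
by apply: cvgM; apply: coord.
Qed.

(** Vector derivatives are coordinatewise, so the scalar product rule applies to each summand. *)
Lemma is_derive_dotp (f g : R -> 'rV[R]_n) (t : R) (df dg : 'rV[R]_n) :
  is_derive t 1 f df -> is_derive t 1 g dg ->
  is_derive t 1 (fun s => dotp (f s) (g s)) (dotp df (g t) + dotp (f t) dg).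
Proof.
have coord (h : R -> 'rV[R]_n) dh k : is_derive t 1 h dh ->
    is_derive t 1 (fun s => h s 0 k) (dh 0 k).
  move=> [dvh <-]; split; last by rewrite derive_mx // mxE.
  by move/derivable_mxP: dvh; exact.
move=> fd gd.
rewrite (_ : (fun s => _) =
    \sum_(k < n) ((fun s => f s 0 k) * (fun s => g s 0 k))); last first.
  by apply/funext => s; rewrite fct_sumE.
have df_k k := is_deriveM (coord f df k fd) (coord g dg k gd).
apply: is_derive_eq (is_derive_sum df_k) _.
rewrite /= /dotp -big_split; apply: eq_bigr => k _ /=.
by rewrite /GRing.scale /=; ring.
Qed.

End dotp.

(** * Inner products of unit vectors *)

Section sphere.
Context {R : realType} {d : nat}.
Implicit Types u v : 'rV[R]_d.+1.

Lemma sphere_dotp u : u \in sphere R d -> dotp u u = 1.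
Proof.
by rewrite inE /sphere /= => u1; rewrite -(sqr_sqrtr (dotp_ge0 u)) u1 expr1n.
Qed.

(** Expand [|u + v|^2 >= 0]. *)
Lemma sphere_dotp_geN1 u v :
  u \in sphere R d -> v \in sphere R d -> -1 <= dotp u v.
Proof.
move=> /sphere_dotp u1 /sphere_dotp v1; have := dotp_ge0 (u + v).
by rewrite dotpDl !dotpDr u1 v1 (dotpC v u); lra.
Qed.

(** Here [|u - v|^2 = 2 - 2 <u, v>] vanishes. *)
Lemma sphere_dotp_eq1 u v :
  u \in sphere R d -> v \in sphere R d -> dotp u v = 1 -> u = v.
Proof.
move=> /sphere_dotp u1 /sphere_dotp v1 uv; apply/subr0_eq/dotp_eq0.
by rewrite dotpDl !dotpDr !dotpNl !dotpNr u1 v1 (dotpC v u) uv; ring.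
Qed.

End sphere.

(* [g^2 exp (- 2 M t)] is nonnegative, nonincreasing and vanishes at [0] *)
Lemma linear_ode_eq0 (R : realType) (g a : R -> R) (M : R) :
  g @ 0^'+ --> g 0 -> g 0 = 0 ->
  (forall t : R, 0 < t -> is_derive t 1 g (a t * g t)) ->
  (forall t : R, 0 < t -> a t <= M) ->
  forall t : R, 0 <= t -> g t = 0.
Proof.
move=> g0c g0 dg aM t; rewrite le_eqVlt => /predU1P[<-//|t0].
pose h (s : R) := g s ^+ 2 * expR (- (2 * M) * s).
have dh (s : R) : 0 < s -> is_derive s 1 h (2 * (a s - M) * h s).
  move=> s0; have gs := dg _ s0.
  have es : is_derive s 1 (fun s : R => expR (- (2 * M) * s))
              (- (2 * M) * expR (- (2 * M) * s)).
    have ls : is_derive s 1 (fun s : R => - (2 * M) * s) (- (2 * M)).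
      by apply: is_derive_eq; rewrite /GRing.scale /= mulr1.
    apply: is_derive_eq (is_derive1_comp _ ls) _.
    by rewrite /GRing.scale /= mulrC.
  rewrite (_ : h = g * g * (fun s : R => expR (- (2 * M) * s))).
    by apply: is_derive_eq; rewrite /h /GRing.scale /= !fctE; ring.
  by apply/funext.
(* No derivative is given at 0, so the monotonicity criterion on [[0, t]] gets its left endpoint
   from right continuity. *)
have hc0 : h @ 0^'+ --> h 0.
  apply: cvgM; first by rewrite expr2; apply: cvgM.
  apply: cvg_at_right_filter; apply: continuous_comp; last exact: continuous_expR.
  by apply: cvgM; [exact: cvg_cst|exact: cvg_id].
have ht : h t <= h 0.
  apply: (@ler0_derive1_le_cc _ h 0 t) => //; rewrite ?in_itv /= ?lexx ?ltW //.
  - by move=> s; rewrite in_itv /= => /andP[/dh[]].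
  - move=> s; rewrite in_itv /= => /andP[s0 _].
    have [_ hs] := dh _ s0; rewrite derive1E hs.
    rewrite mulr_le0_ge0 //; first by have := aM _ s0; lra.
    by rewrite mulr_ge0 ?sqr_ge0 ?expR_ge0.
  - apply/continuous_within_itvP => //; split => //.
      move=> s; rewrite in_itv /= => /andP[/dh[hs _] _].
      exact/differentiable_continuous/derivable1_diffP.
    have [hs _] := dh _ t0; apply: cvg_at_left_filter.
    exact/differentiable_continuous/derivable1_diffP.
apply/eqP; rewrite -sqrf_eq0 eq_le sqr_ge0 andbT.
by move: ht; rewrite /h g0 expr0n mul0r pmulr_lle0 ?expR_gt0.
Qed.

(** * Dynamics of the pairwise gaps *)

Section solution.
Context {R : realType} {d N : nat} {kappa : R}.
Context {x0 : 'I_N -> 'rV[R]_d.+1} {x : 'I_N -> R -> 'rV[R]_d.+1}.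
Hypotheses (kappa_ge0 : 0 <= kappa) (sol : lohe_solution kappa x0 x).

Let coupling i t := kappa / N%:R * \sum_(m < N) dotp (x i t) (x m t).

(** On the sphere this is half the squared distance between two particles. *)
Let gap i j t := 1 - dotp (x i t) (x j t).

(** [coupling] is [kappa] times an average of inner products, each at least -1. This bounds from
    above the coefficient of the linear equation used below. *)
Let coupling_ge i t : 0 <= t -> - kappa <= coupling i t.
Proof.
case: sol => xS _ _ _ t0.
have N0 : (0 < N)%N by apply: leq_ltn_trans (ltn_ord i).
have -> : - kappa = kappa / N%:R * \sum_(m < N) (-1).
  by rewrite sumr_const card_ord -mulr_natr; field; rewrite pnatr_eq0 -lt0n.
rewrite ler_wpM2l ?divr_ge0 //; apply: ler_sum => m _.
by apply: sphere_dotp_geN1; exact: xS.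
Qed.

(** Pairing the field of [k] with [x_l] gives [c_l - c_k <x_k, x_l>], where [c] is [coupling];
    adding the same with [k] and [l] exchanged factors out [c_k + c_l]. *)
Let is_derive_gap i j (t : R) : 0 < t ->
  is_derive t 1 (gap i j) (- (coupling i t + coupling j t) * gap i j t).
Proof.
case: sol => _ _ _ dx t0.
have dotp_field k l : dotp (lohe_field kappa (x^~ t) k) (x l t) =
    coupling l t - coupling k t * dotp (x k t) (x l t).
  rewrite /lohe_field dotpZl dotp_suml /coupling.
  rewrite -[X in _ = _ - X]mulrA -mulrBr mulr_suml -sumrB.
  congr (_ * _); apply: eq_bigr => m _.
  by rewrite dotpDl dotpNl dotpZl (dotpC (x m t)).
have dij := is_derive_dotp _ _ _ _ _ (dx i t t0) (dx j t t0).
rewrite (_ : gap i j = cst 1 - (fun s => dotp (x i s) (x j s))).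
  apply: is_derive_eq.
  by rewrite (dotpC (x i t)) !dotp_field (dotpC (x j t)) !fctE; ring.
by apply/funext.
Qed.

(** The increment is [h] times a difference quotient that converges, hence tends to 0. *)
Lemma lohe_solution_right_continuous i : x i @ 0^'+ --> x i 0.
Proof.
case: sol => _ _ dx0 _.
have id0 : (@id R) @ 0^'+ --> (0 : R).
  by apply: cvg_at_right_filter; exact: cvg_id.
have lim : h *: (h^-1 *: (x i h - x i 0)) + x i 0 @[h --> 0^'+] --> x i 0.
  rewrite -[X in _ --> X]add0r -(scale0r (lohe_field kappa (x^~ 0) i)).
  by apply: cvgD; [exact: cvgZ|exact: cvg_cst].
apply: cvg_trans lim; apply: near_eq_cvg; near=> h.
rewrite /= scalerA divff ?scale1r ?subrK //.
Unshelve. all: by end_near. Qed.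

(* Conservation of the cross ratio, cross-multiplied: no gap has to be shown
   nonzero at positive times. *)
Lemma lohe_cross_ratio i j k l t : 0 <= t ->
  gap i j t * gap k l t * (gap i k 0 * gap j l 0) =
  gap i j 0 * gap k l 0 * (gap i k t * gap j l t).
Proof.
move=> t0; apply/eqP; rewrite -subr_eq0; apply/eqP.
(* Each of the four indices occurs once in either product of moving gaps, so both products, and
   hence [g], solve the same linear equation with coefficient [a]. *)
pose g (s : R) := gap i j s * gap k l s * (gap i k 0 * gap j l 0) -
  gap i j 0 * gap k l 0 * (gap i k s * gap j l s).
pose a (s : R) := - (coupling i s + coupling j s + coupling k s + coupling l s).
have gapc i' j' : gap i' j' @ 0^'+ --> gap i' j' 0.
  by apply: cvgB; [exact: cvg_cst
    |apply: cvg_dotp; exact: lohe_solution_right_continuous].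
(* Four couplings, each at least [- kappa], give the bound [4 * kappa] on [a]. *)
apply: (@linear_ode_eq0 R g a (4 * kappa)) => //.
- apply: cvgB; apply: cvgM; try exact: cvg_cst; exact: cvgM.
- by rewrite /g; ring.
- move=> s s0.
  have := is_derive_gap i j s s0; have := is_derive_gap k l s s0.
  have := is_derive_gap i k s s0; have := is_derive_gap j l s s0.
  move=> djl dik dkl dij.
  rewrite (_ : g = gap i j * gap k l * cst (gap i k 0 * gap j l 0) -
    cst (gap i j 0 * gap k l 0) * (gap i k * gap j l)).
    by apply: is_derive_eq; rewrite /a /g /GRing.scale /= !fctE; ring.
  by apply/funext.
- move=> s /ltW s0; rewrite /a.
  have := coupling_ge i s s0; have := coupling_ge j s s0.
  by have := coupling_ge k s s0; have := coupling_ge l s s0; lra.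
Qed.

Lemma lohe_no_two_opposite_pairs i j k l (p : 'rV[R]_d.+1) :
  p \in sphere R d -> x i 0 <> x j 0 -> x k 0 <> x l 0 ->
  x i t @[t --> +oo] --> p -> x j t @[t --> +oo] --> p ->
  x k t @[t --> +oo] --> - p -> x l t @[t --> +oo] --> - p -> False.
Proof.
move=> /sphere_dotp p1 ij kl xip xjp xkp xlp.
case: sol => xS _ _ _.
(* A zero gap would force two unit vectors to coincide. *)
have gap_neq0 i' j' : x i' 0 <> x j' 0 -> gap i' j' 0 != 0.
  move=> ne; apply/eqP => /subr0_eq /esym /sphere_dotp_eq1 e.
  by apply/ne/e; exact: xS.
have gap_cvg i' j' u v : x i' t @[t --> +oo] --> u -> x j' t @[t --> +oo] --> v ->
    gap i' j' t @[t --> +oo] --> 1 - dotp u v.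
  by move=> xu xv; apply: cvgB; [exact: cvg_cst|exact: cvg_dotp].
have lhs : gap i j t * gap k l t * (gap i k 0 * gap j l 0) @[t --> +oo] -->
    (1 - dotp p p) * (1 - dotp (- p) (- p)) * (gap i k 0 * gap j l 0).
  by apply: cvgM; [apply: cvgM; exact: gap_cvg|exact: cvg_cst].
have rhs : gap i j 0 * gap k l 0 * (gap i k t * gap j l t) @[t --> +oo] -->
    gap i j 0 * gap k l 0 * ((1 - dotp p (- p)) * (1 - dotp p (- p))).
  by apply: cvgM; [exact: cvg_cst|apply: cvgM; exact: gap_cvg].
have : (1 - dotp p p) * (1 - dotp (- p) (- p)) * (gap i k 0 * gap j l 0) =
    gap i j 0 * gap k l 0 * ((1 - dotp p (- p)) * (1 - dotp p (- p))).
  apply: (cvg_unique _ lhs); first exact: Rhausdorff.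
  apply: cvg_trans rhs; apply: near_eq_cvg; near=> t.
  by rewrite /= lohe_cross_ratio.
(* Gaps at a common pole tend to 0 and gaps between opposite poles to 2, so the limit identity says
   that 4 times two nonzero initial gaps is 0. *)
rewrite dotpNl !dotpNr p1 => /esym/eqP.
rewrite !opprK subrr !mul0r !mulf_eq0 !(negbTE (gap_neq0 _ _ _)) //=.
by rewrite orbb -mulr2n pnatr_eq0.
Unshelve. all: by end_near. Qed.

End solution.

Theorem corollary4p1 (R : realType) (d N : nat) (kappa : R)
    (x0 : 'I_N -> 'rV[R]_d.+1) (x : 'I_N -> R -> 'rV[R]_d.+1)
    (pole : 'rV[R]_d.+1)
    (hd : (1 <= d)%N) (hkappa : 0 <= kappa)
    (hx0 : forall i : 'I_N, x0 i \in sphere R d)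
    (hsol : lohe_solution kappa x0 x)
    (hdistinct : forall i j : 'I_N, i != j -> x0 i <> x0 j)
    (hpole : pole \in sphere R d) :
  (minn (num_converging x pole) (num_converging x (- pole)) <= 1)%N.
Proof.
(* If both counts exceed 1, each pole attracts two distinct indices. *)
rewrite leqNgt leq_min; apply/negP => /andP[/card_gt1P[i [j [ip jp ij]]]].
move=> /card_gt1P[k [l [kp lp kl]]].
move: ip jp kp lp; rewrite !inE => ip jp kp lp.
have [_ x0E _ _] := hsol.
apply: (lohe_no_two_opposite_pairs hkappa hsol i j k l pole) => //;
  by rewrite !x0E; exact: hdistinct.
Qed.
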